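(* Let $X=X_-\cup X_+$ with $X_-=(-1,0]$ and $X_+=(0,1]$, and let $T=X_+$. Equip $X$ and $T$ with the normalized Lebesgue measures $m$ and $p$, respectively. Let $\iota:X\to X$ be the involution given by $\iota(x)=x+1$ for $x\in X_-$ and $\iota(x)=x-1$ for $x\in X_+$. Let $f_0:X\to X$ be a measurable map such that $f_0(X_-)\subset X_+$, $f_0(X_+)\subset X_-$ and $f_0\circ\iota=\iota\circ f_0$ on $X_+$. Define $\widetilde f:T\times X_+\to X_+$ by $\widetilde f_t(x)=\iota\circ f_0(x)+t\pmod 1$ (with representative in $(0,1]$), and let $f:T\times X\to X$ be the random map $$f_t(x)=\begin{cases}\iota\circ\widetilde f_t(x)&\text{for }x\in X_+,\\ \widetilde f_t\circ\iota(x)&\text{for }x\in X_-.\end{cases}$$ Then the transition probability $P(x,A)$ associated with $f$ satisfies (D), but does not satisfy (D* ).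
   Context: $P(x,A)=p(\{t\in T:f_t(x)\in A\})$ for $x\in X$ and Borel $A\subset X$. The $n$-th transition probabilities are $P^1=P$, $P^n(x,A)=\int P^{n-1}(y,A)\,P(x,dy)$. (D): there exist $n_0\ge1$, $0<\varepsilon<1$, $\delta>0$ and a probability measure $\mu$ absolutely continuous with respect to $m$ such that $P^{n_0}(x,A)<\varepsilon$ for all $x\in X$ and all Borel $A$ with $\mu(A)<\delta$. (D* ): there exist $n_0\ge1$, $0<\varepsilon<1$, $\delta>\frac12$ and a probability measure $\mu$ absolutely continuous with respect to $m$ such that $P^{n_0}(x,A)<\varepsilon$ for all $x\in X$ and all Borel $A$ with $\mu(A)<\delta$. *)

(* Defs.v *)
From HB Require Import structures.
From mathcomp Require Import all_boot all_order all_algebra lra.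
From mathcomp Require Import all_classical all_reals all_analysis.

Set Implicit Arguments.
Unset Strict Implicit.
Unset Printing Implicit Defensive.

Import Order.TTheory GRing.Theory Num.Theory.
Import numFieldNormedType.Exports.

Local Open Scope classical_set_scope.
Local Open Scope ring_scope.

Section transition_probability.
Context {R : realType} {dX : measure_display} {X : measurableType dX}.
Local Open Scope ereal_scope.

Definition transition {dT : measure_display} {T : measurableType dT}
    (p : probability T R) (f : T -> X -> X) (x : X) (A : set X) : \bar R :=
  p [set t | A (f t x)].

(* The value at [n = 0] (the identity kernel) is only a convention: conditions
   (D) and (D* ) below use [n >= 1]. *)
Fixpoint iter_transition (P : X -> set X -> \bar R) (n : nat) (x : X)
    (A : set X) {struct n} : \bar R :=
  match n with
  | 0 => \d_x A
  | n'.+1 =>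
    match n' with
    | 0 => P x A
    | _ => \int[P x]_y iter_transition P n' y A
    end
  end.

Definition condition_D (m : set X -> \bar R) (P : X -> set X -> \bar R) : Prop :=
  exists (n0 : nat) (eps delta : R) (mu : probability X R),
    [/\ (1 <= n0)%N, (0 < eps < 1)%R, (0 < delta)%R, mu `<< m &
        forall (x : X) (A : set X), measurable A ->
          mu A < delta%:E -> iter_transition P n0 x A < eps%:E].

Definition condition_Dstar (m : set X -> \bar R) (P : X -> set X -> \bar R) :
    Prop :=
  exists (n0 : nat) (eps delta : R) (mu : probability X R),
    [/\ (1 <= n0)%N, (0 < eps < 1)%R, (2^-1 < delta)%R, mu `<< m &
        forall (x : X) (A : set X), measurable A ->
          mu A < delta%:E -> iter_transition P n0 x A < eps%:E].

End transition_probability.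

(* The half-open interval (a, b] as a type, with its Borel sigma-algebra (the
   trace of that of R).  The proof [ab] is used to show that it is nonempty. *)
Record oc_interval (R : realType) (a b : R) (ab : a < b) := OCInterval {
  oc_val :> R;
  oc_valP : oc_val \in `]a, b] }.

Section oc_interval_structure.
Context {R : realType} {a b : R} (ab : a < b).

HB.instance Definition _ := [isSub for @oc_val R a b ab].
HB.instance Definition _ := [Choice of oc_interval ab by <:].

Let right_end_in : b \in `]a, b].
Proof. by rewrite in_itv/= ab lexx. Qed.

HB.instance Definition _ :=
  isPointed.Build (oc_interval ab) (OCInterval ab right_end_in).

HB.instance Definition _ := Measurable.copy (oc_interval ab)
  (g_sigma_algebra_preimageType (@oc_val R a b ab)).

Lemma oc_val_inj : injective (@oc_val R a b ab).
Proof. exact: val_inj. Qed.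

Lemma measurable_oc_val : measurable_fun setT (@oc_val R a b ab).
Proof. by move=> _ B mB; exists B. Qed.

Lemma measurable_oc_val_image (A : set (oc_interval ab)) :
  measurable A -> measurable (@oc_val R a b ab @` A).
Proof.
move=> [B mB <-]; rewrite setTI.
rewrite [X in measurable X](_ : _ = B `&` `]a, b]%classic).
  by apply: measurableI => //; exact: measurable_itv.
apply/seteqP; split=> [_ [x Bx <-]|x [Bx xab]] /=.
  by split=> //; exact: oc_valP.
by exists (OCInterval ab xab).
Qed.

Definition normalized_lebesgue (A : set (oc_interval ab)) : \bar R :=
  ((b - a)^-1%:E * lebesgue_measure (@oc_val R a b ab @` A))%E.

Let normalized_lebesgue0 : normalized_lebesgue set0 = 0%E.
Proof. by rewrite /normalized_lebesgue image_set0 measure0 mule0. Qed.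

Let normalized_lebesgue_ge0 A : (0 <= normalized_lebesgue A)%E.
Proof. by rewrite mule_ge0// lee_fin invr_ge0 subr_ge0 ltW. Qed.

Let normalized_lebesgue_sigma_additive :
  semi_sigma_additive normalized_lebesgue.
Proof.
move=> F mF tF mUF; rewrite /normalized_lebesgue image_bigcup.
under eq_fun do rewrite -ge0_sume_distrr//.
apply: cvgeZl => //.
apply: measure_semi_sigma_additive.
- by move=> i; exact: measurable_oc_val_image.
- apply/trivIsetP => i j _ _ ij.
  rewrite -subset0 => _ [[x Fx <-] [y Fy /oc_val_inj yx]].
  have : (F i `&` F j) x by split=> //; rewrite -yx.
  by move/trivIsetP : tF => ->.
- by apply: bigcup_measurable => k _; exact: measurable_oc_val_image.
Qed.

HB.instance Definition _ := isMeasure.Build _ _ _ normalized_lebesgue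
  normalized_lebesgue0 normalized_lebesgue_ge0
  normalized_lebesgue_sigma_additive.

Let normalized_lebesgue_setT : normalized_lebesgue setT = 1%E.
Proof.
rewrite /normalized_lebesgue (_ : _ @` _ = `]a, b]%classic); last first.
  apply/seteqP; split=> [_ [x _ <-]|x xab] /=; first exact: oc_valP.
  by exists (OCInterval ab xab).
rewrite lebesgue_measure_itv/= lte_fin ab -EFinD -EFinM mulVf//.
by rewrite subr_eq0 gt_eqF.
Qed.

HB.instance Definition _ := Measure_isProbability.Build _ _ _
  normalized_lebesgue normalized_lebesgue_setT.

End oc_interval_structure.
Arguments normalized_lebesgue {R a b} ab A.

Section circle_extension.
Context (R : realType).

Lemma ltrN1_1 : (-1 : R) < 1.
Proof. by rewrite gtrN. Qed.

Definition spaceX := oc_interval ltrN1_1.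

Definition spaceT := oc_interval (@ltr01 R).

Definition leb_X : probability spaceX R := normalized_lebesgue ltrN1_1.

Definition leb_T : probability spaceT R := normalized_lebesgue (@ltr01 R).

Definition Xminus : set spaceX := [set x | (x : R) <= 0].

Definition Xplus : set spaceX := [set x | 0 < (x : R)].

Lemma swap_subproof (x : spaceX) :
  (if (x : R) <= 0 then (x : R) + 1 else (x : R) - 1) \in `]-1, 1].
Proof.
have := oc_valP x; rewrite !in_itv/= => /andP[x1 x2].
by case: (leP (x : R) 0) => x0; apply/andP; split; lra.
Qed.

Definition swap (x : spaceX) : spaceX := OCInterval ltrN1_1 (swap_subproof x).

Lemma mod1_subproof (y : R) : y - (Num.ceil y)%:~R + 1 \in `]-1, 1].
Proof.
rewrite in_itv/=; apply/andP; split.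
  by have := ceilB1_lt y; rewrite intrB; lra.
by have := ceil_ge y; lra.
Qed.

(* The representative of y modulo 1 in (0, 1], as a point of X. *)
Definition mod1 (y : R) : spaceX := OCInterval ltrN1_1 (mod1_subproof y).

(* The map ftilde_t of X+ to itself; it takes all of X as domain, but [random_f]
   only applies it to points of [Xplus]. *)
Definition ftilde (f0 : spaceX -> spaceX) (t : spaceT) (x : spaceX) : spaceX :=
  mod1 ((swap (f0 x) : R) + (t : R)).

Definition random_f (f0 : spaceX -> spaceX) (t : spaceT) (x : spaceX) :
    spaceX :=
  if 0 < (x : R) then swap (ftilde f0 t x) else ftilde f0 t (swap x).

End circle_extension.

(* Main.v *)
Require Import Defs.
From mathcomp Require Import all_boot all_order all_algebra lra.
From mathcomp Require Import all_classical all_reals all_analysis.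
From mathcomp Require Import measurable_realfun.

Set Implicit Arguments.
Unset Strict Implicit.
Unset Printing Implicit Defensive.

Import Order.TTheory GRing.Theory Num.Theory.

Local Open Scope classical_set_scope.
Local Open Scope ring_scope.

(** Two features of the random map decide the two claims.

    Condition (D) holds already in one step.  For a fixed starting point x, the
    map t |-> f_t(x) is a rotation of a circle of length one read on a
    half-open interval, so it cuts (0, 1] at one point at most and translates
    each piece ([random_f_two_translations]).  By translation invariance of
    Lebesgue measure, the times t that send x into A therefore have
    probability at most twice the Lebesgue measure of A, which is four times
    its normalized measure, since X has length two
    ([transition_random_f_le]).  Hence P(x, .) is absolutely continuous with
    respect to m, uniformly in x, and mu = m serves in (D).

    Condition (D* ) fails because the random map exchanges X_- and X_+
    ([random_f_alternating]).  The n-step probability of hitting either half is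
    therefore 0 or 1, according to the parity of n and the half the walk starts
    from ([iter_transition_alternating]).  Whatever the probability measure mu,
    one of the halves has mu-measure at most 1/2, hence below delta, and yet it
    is reached with probability 1 from every point of one of the halves
    ([alternating_not_Dstar]).  This second part concerns any random map that
    exchanges a measurable set with its complement. *)

Section alternating_random_map.
Context {R : realType} {dX dT : measure_display}.
Context {X : measurableType dX} {T : measurableType dT}.
Variables (p : probability T R) (g : T -> X -> X).

Lemma transition_pushforward x : transition p g x = pushforward p (g^~ x).
Proof. by []. Qed.

Lemma transition_alternating (B : set X) x :
  (forall t x, B (g t x) <-> ~ B x) -> transition p g x B = (\1_(~` B) x)%:E.
Proof.
move=> gB; rewrite /transition indicE; have [Bx|nBx] := pselect (B x).
- rewrite memNset; last by move/(_ Bx).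
  rewrite [X in p X](_ : _ = set0) ?measure0//.
  by apply/seteqP; split=> t //= /gB.
- rewrite mem_set//.
  rewrite [X in p X](_ : _ = setT) ?probability_setT//.
  by apply/seteqP; split=> t //= _; apply/gB.
Qed.

Hypothesis mg : forall x, measurable_fun [set: T] (g^~ x).

(** Each step exchanges B and its complement, so the walk is in B after n steps
    exactly when it started in B (n even) or outside B (n odd).  In the
    induction the integrand is an indicator, so the integral is a one-step
    probability of B or of its complement; it is to evaluate the integral that
    P(x, .) must be recognized as a measure. *)
Lemma iter_transition_alternating (B : set X) n x :
  measurable B -> (forall t x, B (g t x) <-> ~ B x) ->
  iter_transition (transition p g) n x B =
  (\1_(if odd n then ~` B else B) x)%:E.
Proof.
move=> mB gB; elim: n x => [|[_|n IH]] x.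
- by rewrite /= diracE indicE.
- exact: transition_alternating.
- have gBC t y : (~` B) (g t y) <-> ~ (~` B) y.
    by rewrite /setC/= gB.
  transitivity (\int[transition p g x]_y
      (\1_(if odd n.+1 then ~` B else B) y)%:E)%E.
    by congr (integral _ _ _); apply/funext => y; exact: IH.
  have mC : measurable (if odd n.+1 then ~` B else B).
    by case: ifP => _ //; exact: measurableC.
  rewrite transition_pushforward (integral_indic _ measurableT mC) ?setIT.
  change (transition p g x (if odd n.+1 then ~` B else B) =
    (\1_(if odd n.+2 then ~` B else B) x)%:E).
  by rewrite /=; case: (odd n) => /=; rewrite transition_alternating // setCK.
Qed.

(** Of B and its complement, take the one with probability at most 1/2 under mu:
    a walk started on the side prescribed by the parity of n is nonetheless
    certain to be in it after n steps. *)
Lemma alternating_not_Dstar (m : set X -> \bar R) (B : set X) :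
  measurable B -> (forall t x, B (g t x) <-> ~ B x) ->
  B !=set0 -> ~` B !=set0 -> ~ condition_Dstar m (transition p g).
Proof.
move=> mB gB B0 BC0 [n] [eps] [delta] [mu] [_ /andP[_ eps1] delta12 _ PD].
(* B and its complement play symmetric roles: take the smaller one. *)
wlog muB : B mB gB B0 BC0 / (mu B <= 2^-1%:E)%E.
  move=> wl; have [|muB] := leP (mu B) 2^-1%:E; first exact: wl.
  apply: (wl (~` B)) => //.
  - exact: measurableC.
  - by move=> t x; rewrite /setC/= gB.
  - by rewrite setCK.
  rewrite probability_setC//; move: muB.
  have := fin_num_measure mu B mB.
  case: (mu B) => // r _; rewrite lte_fin -EFinB lee_fin; lra.
have [x Cx] : exists x, (if odd n then ~` B else B) x by case: ifP.
have /(PD x B mB) : (mu B < delta%:E)%E by apply: le_lt_trans muB _.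
rewrite iter_transition_alternating// indicE mem_set// lte_fin.
by rewrite ltNge (ltW eps1).
Qed.

End alternating_random_map.

Section circle_extension_theory.
Context {R : realType}.
Local Notation mu := (@lebesgue_measure R).

Lemma lebesgue_measure_shift (a : R) (A : set R) : measurable A ->
  mu ((fun x => x + a) @^-1` A) = mu A.
Proof.
move=> mA.
have mf : measurable_fun [set: measurableTypeR R]
    ((fun x => x + a) : measurableTypeR R -> measurableTypeR R).
  exact: measurable_funD.
rewrite -[LHS]/(pushforward mu ((fun x => x + a) : _ -> measurableTypeR R) A).
apply/esym/lebesgue_measure_unique => //= _ [[u v]] _ <-.
rewrite /pushforward/= [X in _ = mu X](_ : _ = `]u - a, v - a]%classic).
  rewrite !lebesgue_measure_itv/= !lte_fin ltrD2r; case: ifP => // _.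
  by rewrite -!EFinB; congr EFin; lra.
by apply/seteqP; split=> x /=; rewrite !in_itv/= ltrBlDr lerBrDr.
Qed.

Lemma measurable_fun_oc_interval d (T : measurableType d) (a b : R)
    (ab : a < b) (g : T -> oc_interval ab) :
  measurable_fun setT (fun t => g t : R) -> measurable_fun setT g.
Proof. by move=> mg mD _ [B mB <-]; rewrite setTI; exact: (mg mD B mB). Qed.

Variable f0 : spaceX R -> spaceX R.

Lemma mod1_in_Xplus (y : R) : Xplus (mod1 y).
Proof. by rewrite /Xplus/=; have := ceilB1_lt y; rewrite intrB; lra. Qed.

Lemma swap_XplusN (x : spaceX R) : Xplus (swap x) <-> ~ Xplus x.
Proof.
rewrite /Xplus /=; have := oc_valP x; rewrite in_itv/= => /andP[x1 x2].
case: (leP (x : R) 0) => x0; split; first lra.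
- lra.
- lra.
- by move=> /(_ isT).
Qed.

Lemma random_f_alternating t (x : spaceX R) :
  Xplus (random_f f0 t x) <-> ~ Xplus x.
Proof.
rewrite /random_f; case: ifPn => [x0|x0].
- rewrite swap_XplusN; split=> h; first by case: h; exact: mod1_in_Xplus.
  by case: (h x0).
- by split=> _; [exact/negP|exact: mod1_in_Xplus].
Qed.

(** With c the starting angle, c + t runs through an interval (c, c + 1] as t
    runs through (0, 1], so ceil (c + t) jumps only once, from ceil c to
    ceil c + 1, at s = ceil c - c.  The pieces are kept as translations by real
    numbers rather than as a rotation modulo 1: this form gives both the
    measurability in t and the bound on transition probabilities. *)
Lemma random_f_two_translations (x : spaceX R) : exists s a b : R,
  forall t, (random_f f0 t x : R) =
    if (t : R) <= s then (t : R) + a else (t : R) + b.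
Proof.
have mod1E (c : R) (t : spaceT R) :
    (mod1 (c + (t : R)) : R) = if (t : R) <= (Num.ceil c)%:~R - c
      then (t : R) + (c - (Num.ceil c)%:~R + 1)
      else (t : R) + (c - (Num.ceil c)%:~R).
  have := oc_valP t; rewrite in_itv/= => /andP[t0 t1].
  have := ceilB1_lt c; have := ceil_ge c; rewrite intrB => c1 c2.
  rewrite [LHS]/=; case: ifPn => ts.
     have -> : Num.ceil (c + (t : R)) = Num.ceil c.
      by apply: ceil_def; rewrite intrB; apply/andP; split; lra.
    by lra.
  have -> : Num.ceil (c + (t : R)) = Num.ceil c + 1.
    rewrite -ltNge in ts.
    by apply: ceil_def; rewrite addrK intrD; apply/andP; split; lra.
  by rewrite intrD; lra.
have [x0|/negPf x0] := boolP (0 < (x : R)).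
- set c := (swap (f0 x) : R).
  exists ((Num.ceil c)%:~R - c), (c - (Num.ceil c)%:~R),
    (c - (Num.ceil c)%:~R - 1) => t; rewrite /random_f x0.
  have -> : (swap (ftilde f0 t x) : R) = (ftilde f0 t x : R) - 1.
    have h : 0 < (ftilde f0 t x : R) by exact: mod1_in_Xplus.
    by rewrite [LHS]/= leNgt h.
  by rewrite /ftilde mod1E -/c; case: ifPn => _; lra.
- set c := (swap (f0 (swap x)) : R).
  exists ((Num.ceil c)%:~R - c), (c - (Num.ceil c)%:~R + 1),
    (c - (Num.ceil c)%:~R) => t.
  by rewrite /random_f x0 /ftilde mod1E.
Qed.

Lemma measurable_random_f (x : spaceX R) :
  measurable_fun setT (fun t => random_f f0 t x).
Proof.
apply: measurable_fun_oc_interval.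
have [s [a [b]]] := random_f_two_translations x => /funext ->.
have mv := @measurable_oc_val R 0 1 ltr01.
apply: measurable_fun_ifT.
- exact: measurable_fun_ler.
- exact: measurable_funD.
- exact: measurable_funD.
Qed.

(** The set of times that send x into A is covered by two translates of A,
    whence a factor 2; the normalization of m, by the length 2 of X, contributes
    the other factor 2.  The exact value is twice the measure of the part of A
    that lies in the half of X opposite to x, but any uniform multiple of m(A)
    yields (D). *)
Lemma transition_random_f_le (x : spaceX R) (A : set (spaceX R)) :
  measurable A ->
  (transition (leb_T R) (random_f f0) x A <= 4%:E * leb_X R A)%E.
Proof.
move=> mA; have [s [a [b fE]]] := random_f_two_translations x.
rewrite /transition /leb_T /leb_X /= /normalized_lebesgue subr0 invr1 mul1e.
set A' := @oc_val R (-1) 1 (ltrN1_1 R) @` A.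
have mA' : measurable A' by exact: measurable_oc_val_image.
have mshift c : measurable ((fun y : R => y + c) @^-1` A').
  rewrite -[X in measurable X]setTI.
  exact: (measurable_funD (@measurable_id _ R setT) (measurable_cst c)).
have mS : measurable [set t : spaceT R | A (random_f f0 t x)].
  by rewrite -[X in measurable X]setTI; exact: measurable_random_f.
apply: (@le_trans _ _ (mu ((fun y : R => y + a) @^-1` A' `|`
                           (fun y : R => y + b) @^-1` A'))).
  apply: le_measure; rewrite ?inE.
  - exact: measurable_oc_val_image.
  - by apply: measurableU; exact: mshift.
  - move=> _ [t /= At <-]; have := fE t; case: ifP => _ ft; [left|right];
    by exists (random_f f0 t x).
apply: (@le_trans _ _ (mu ((fun y => y + a)%R @^-1` A') +
                       mu ((fun y => y + b)%R @^-1` A'))%E).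
  by apply: measureU2; exact: mshift.
rewrite !lebesgue_measure_shift// muleA -EFinM.
rewrite (_ : 4 * (1 - -1)^-1 = 2 :> R); last first.
  by rewrite opprK -[1 + 1]/(2 : R); lra.
by rewrite mule_natl mule2n.
Qed.

End circle_extension_theory.

Theorem proposition1p14 (R : realType) (f0 : spaceX R -> spaceX R)
    (mf0 : measurable_fun [set: spaceX R] f0)
    (f0_minus : f0 @` @Xminus R `<=` @Xplus R)
    (f0_plus : f0 @` @Xplus R `<=` @Xminus R)
    (f0_swap : forall x : spaceX R, Xplus x -> f0 (swap x) = swap (f0 x)) :
  condition_D (leb_X R) (transition (leb_T R) (random_f f0)) /\
  ~ condition_Dstar (leb_X R) (transition (leb_T R) (random_f f0)).
Proof.
split.
  (* m(A) < 1/8 forces P(x, A) <= 4 m(A) < 1/2. *)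
  exists 1, 2^-1, 8^-1, (leb_X R); split=> //.
  - by apply/andP; split; lra.
  - move=> x A mA A8; apply: le_lt_trans (transition_random_f_le _ _ mA) _.
    rewrite -lte_pdivlMl//; apply: (lt_le_trans A8).
    by rewrite -EFinM lee_fin; lra.
have mXplus : measurable (@Xplus R).
  rewrite -[X in measurable X]setTI.
  have -> : @Xplus R = (@oc_val R (-1) 1 (ltrN1_1 R)) @^-1` `]0, +oo[%classic.
    by apply/seteqP; split=> x /=; rewrite /Xplus/= in_itv/= andbT.
  by apply: measurable_oc_val.
apply: (@alternating_not_Dstar _ _ _ _ _ _ _ _ _ (@Xplus R)) => //.
- exact: measurable_random_f.
- exact: random_f_alternating.
- by exists (mod1 0); exact: mod1_in_Xplus.
- by exists (swap (mod1 0)) => /swap_XplusN; apply; exact: mod1_in_Xplus.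
Qed.
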